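(* Let $c_n$ be the number of $U_kF$-equivalence classes of the set $\mathcal{L}_n$ of Łukasiewicz paths of length $n$. Then $$\sum_{n\geq0}c_nx^n=\frac{1-x+2x^2+\sqrt{1-2x+x^2-4x^3}}{1-2x+2x^2-3x^3+(1-x+x^2)\sqrt{1-2x+x^2-4x^3}}=\frac{2}{1-x+\sqrt{1-2x+x^2-4x^3}},$$ and $c_n=h_n$, where $h_0=1$ and $h_{n+1}=h_n+\sum_{k=0}^{n-2}h_kh_{n-2-k}$ for $n\geq0$.
   Context: A Łukasiewicz path of length $n$ is a sequence of $n$ steps from $\{(1,i): i\geq -1\}$ starting at $(0,0)$, ending at $(n,0)$ and never going below the $x$-axis. Write $D=(1,-1)$, $F=(1,0)$, $U_k=(1,k)$ for $k\geq1$. Steps are numbered $1,\dots,n$; an occurrence of $U_kF$ is at position $i$ if its $U_k$ is the $i$-th step. Two Łukasiewicz paths of the same length are $U_kF$-equivalent if for every $k\geq1$ the set of occurrence positions of $U_kF$ is the same in both. *)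

(* Defs.v *)
From HB Require Import structures.
From mathcomp Require Import all_boot all_order all_algebra finmap.
From mathcomp Require Import boolp classical_sets functions cardinality.
Set Implicit Arguments.
Unset Strict Implicit.
Unset Printing Implicit Defensive.
Import Order.TTheory GRing.Theory Num.Theory.
Local Open Scope ring_scope.

(** * Formal power series in one variable over a field *)

Record fps (K : Type) := FPS { fcoef : nat -> K }.

Section FPSRing.
Variable K : fieldType.
Implicit Types f g h : fps K.

Lemma fpsP f g : fcoef f =1 fcoef g -> f = g.
Proof. by case: f g => f [g] /= /funext ->. Qed.

HB.instance Definition _ := gen_eqMixin (fps K).
HB.instance Definition _ := gen_choiceMixin (fps K).

Definition fps0 := FPS (fun=> 0 : K).
Definition fps1 := FPS (fun n => (n == 0)%:R : K).
Definition fps_opp f := FPS (fun n => - fcoef f n).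
Definition fps_add f g := FPS (fun n => fcoef f n + fcoef g n).
Definition fps_mul f g :=
  FPS (fun n => \sum_(i < n.+1) fcoef f i * fcoef g (n - i)).

Fact fps_addA : associative fps_add.
Proof. by move=> f g h; apply: fpsP => n /=; rewrite addrA. Qed.
Fact fps_addC : commutative fps_add.
Proof. by move=> f g; apply: fpsP => n /=; rewrite addrC. Qed.
Fact fps_add0 : left_id fps0 fps_add.
Proof. by move=> f; apply: fpsP => n /=; rewrite add0r. Qed.
Fact fps_addN : left_inverse fps0 fps_opp fps_add.
Proof. by move=> f; apply: fpsP => n /=; rewrite addNr. Qed.

HB.instance Definition _ := GRing.isZmodule.Build (fps K)
  fps_addA fps_addC fps_add0 fps_addN.

Let agree N f (p : {poly K}) := forall i, (i <= N)%N -> fcoef f i = p`_i.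
Let trunc N f : {poly K} := \poly_(i < N.+1) fcoef f i.

Let agree_trunc N f : agree N f (trunc N f).
Proof. by move=> i iN; rewrite coef_poly ltnS iN. Qed.

Let agree_mul N f g p q : agree N f p -> agree N g q ->
  agree N (fps_mul f g) (p * q).
Proof.
move=> fp gq i iN; rewrite coefM /=; apply: eq_bigr => j _.
by rewrite fp ?gq // (leq_trans _ iN) ?leq_subr // -ltnS.
Qed.

Fact fps_mulA : associative fps_mul.
Proof.
move=> f g h; apply: fpsP => n.
have [[F G] H] := (@agree_trunc n f, @agree_trunc n g, @agree_trunc n h).
apply: etrans (agree_mul F (agree_mul G H) (leqnn n)) _.
by rewrite mulrA; apply/esym/(agree_mul (agree_mul F G) H (leqnn n)).
Qed.
Fact fps_mulC : commutative fps_mul.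
Proof.
move=> f g; apply: fpsP => n.
have [F G] := (@agree_trunc n f, @agree_trunc n g).
apply: etrans (agree_mul F G (leqnn n)) _.
by rewrite mulrC; apply/esym/(agree_mul G F (leqnn n)).
Qed.
Fact fps_mul1 : left_id fps1 fps_mul.
Proof.
move=> f; apply: fpsP => n /=.
by rewrite big_ord_recl /= mul1r subn0 big1 ?addr0 // => i _; rewrite mul0r.
Qed.
Fact fps_mulDl : left_distributive fps_mul fps_add.
Proof.
move=> f g h; apply: fpsP => n /=.
by rewrite -big_split; apply: eq_bigr => i _; rewrite mulrDl.
Qed.
Fact fps1_neq0 : fps1 != 0.
Proof.
by apply/eqP => /(congr1 (fun f => fcoef f 0)) /eqP /=; rewrite oner_eq0.
Qed.

HB.instance Definition _ := GRing.Zmodule_isComNzRing.Build (fps K)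
  fps_mulA fps_mulC fps_mul1 fps_mulDl fps1_neq0.

Lemma fcoef0 n : fcoef (0 : fps K) n = 0. Proof. by []. Qed.
Lemma fcoef1 n : fcoef (1 : fps K) n = (n == 0)%:R. Proof. by []. Qed.
Lemma fcoefD f g n : fcoef (f + g) n = fcoef f n + fcoef g n.
Proof. by []. Qed.
Lemma fcoefN f n : fcoef (- f) n = - fcoef f n. Proof. by []. Qed.
Lemma fcoefM f g n :
  fcoef (f * g) n = \sum_(i < n.+1) fcoef f i * fcoef g (n - i).
Proof. by []. Qed.
Lemma fcoefM0 f g : fcoef (f * g) 0 = fcoef f 0 * fcoef g 0.
Proof. by rewrite fcoefM big_ord1. Qed.

Definition fpsX : fps K := FPS (fun n => (n == 1)%:R).

(** Course-of-values recursion: [F] computes the [n]-th term from the list of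
    the first [n] terms. *)
Fixpoint cov_prefix (F : seq K -> K) (n : nat) : seq K :=
  if n is m.+1 then rcons (cov_prefix F m) (F (cov_prefix F m)) else [::].
Definition cov (F : seq K -> K) (n : nat) : K := F (cov_prefix F n).

Lemma size_cov_prefix F n : size (cov_prefix F n) = n.
Proof. by elim: n => //= n IHn; rewrite size_rcons IHn. Qed.

Lemma nth_cov_prefix F n i : (i < n)%N -> (cov_prefix F n)`_i = cov F i.
Proof.
elim: n => // n IHn; rewrite ltnS leq_eqVlt /= nth_rcons size_cov_prefix.
by case/orP=> [/eqP ->|lt_in]; rewrite ?ltnn ?eqxx // lt_in IHn.
Qed.

(** A series is invertible when its constant term is nonzero; on other series
    the inverse is the identity, as for every [unitRingType]. *)
Definition fps_unit : pred (fps K) := fun f => fcoef f 0 != 0.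

Definition fps_inv f : fps K :=
  if fps_unit f then
    FPS (cov (fun s => ((size s == 0)%:R
      - \sum_(i < size s) s`_i * fcoef f (size s - i)) / fcoef f 0))
  else f.

Fact fps_mulVr : {in fps_unit, left_inverse 1 fps_inv *%R}.
Proof.
move=> f uf; apply: fpsP => n; rewrite fcoefM /fps_inv.
have f0 : fps_unit f by []; rewrite f0.
rewrite big_ord_recr /= subnn [cov _ n]/cov /= size_cov_prefix divfK //.
rewrite addrC -addrA (_ : - _ + _ = 0) ?addr0 //.
by apply/eqP; rewrite addrC subr_eq0; apply/eqP/eq_bigr => i _;
  rewrite nth_cov_prefix.
Qed.
Fact fps_unitP f g : g * f = 1 -> fps_unit f.
Proof.
move/(congr1 (fun h => fcoef h 0)); rewrite fcoefM0 fcoef1 => gf1.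
by apply/eqP => f0; move/eqP: gf1; rewrite f0 mulr0 eq_sym oner_eq0.
Qed.
Fact fps_inv_out : {in [predC fps_unit], fps_inv =1 id}.
Proof. by move=> f; rewrite inE /= /fps_inv => /negbTE; rewrite /in_mem /= => ->. Qed.

HB.instance Definition _ := GRing.ComNzRing_hasMulInverse.Build (fps K)
  fps_mulVr fps_unitP fps_inv_out.

Lemma fps_unitE f : (f \is a GRing.unit) = (fcoef f 0 != 0).
Proof. by []. Qed.

(** The square root with constant term 1 of a series with constant term 1, in
    characteristic different from 2: for [0 < n] the coefficient of [x^n] in
    [s * s] is [2 s_n + \sum_(0 < i < n) s_i s_(n-i)]. *)
Definition fps_sqrt f : fps K :=
  FPS (cov (fun s => if size s == 0 then 1 else
    (fcoef f (size s) - \sum_(1 <= i < size s) s`_i * s`_(size s - i)) / 2%:R)).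

Lemma fcoef_sqrt0 f : fcoef (fps_sqrt f) 0 = 1. Proof. by []. Qed.

Lemma fps_sqr_sqrt f : 2%:R != 0 :> K -> fcoef f 0 = 1 -> fps_sqrt f ^+ 2 = f.
Proof.
move=> nz2 f0; apply: fpsP => -[|n].
  by rewrite expr2 fcoefM0 fcoef_sqrt0 mulr1 f0.
rewrite expr2 fcoefM; set s := fcoef (fps_sqrt f).
have s0 : s 0 = 1 by [].
rewrite -(big_mkord xpredT (fun i => s i * s (n.+1 - i)%N)).
rewrite big_nat_recr //= big_nat_recl // subn0 subnn s0 mul1r mulr1.
have -> : s n.+1 =
    (fcoef f n.+1 - \sum_(1 <= i < n.+1) s i * s (n.+1 - i)%N) / 2%:R.
  rewrite {1}/s [LHS]/= {1}/cov size_cov_prefix [_ == 0]/=.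
  congr ((_ - _) / _); rewrite big_nat_cond [RHS]big_nat_cond.
  apply: eq_bigr => i; rewrite andbT => /andP[i_gt0 i_lt].
  by rewrite !nth_cov_prefix // ltn_subrL i_gt0.
rewrite -(big_add1 _ _ 0 n.+1 xpredT (fun i => s i * s (n.+1 - i)%N)).
rewrite addrAC -mulr2n -[_ *+ 2]mulr_natr divfK //.
by rewrite subrK.
Qed.

Lemma fps_sqrt_unique f g : 2%:R != 0 :> K -> fcoef f 0 = 1 ->
  fcoef g 0 = 1 -> g ^+ 2 = f -> g = fps_sqrt f.
Proof.
move=> nz2 f0 g0 gf; apply/eqP; rewrite -subr_eq0; apply/eqP.
have u : g + fps_sqrt f \is a GRing.unit.
  by rewrite fps_unitE fcoefD g0 fcoef_sqrt0.
by apply: (mulIr u); rewrite mul0r -subr_sqr gf fps_sqr_sqrt // subrr.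
Qed.

End FPSRing.

Arguments fpsX {K}.

(** * Łukasiewicz paths *)

(** A path is the list of the vertical components of its steps: [i] stands for
    the step [(1, i)], so that [D], [F] and [U_k] are [-1], [0] and [k]. *)
Definition path_height (p : seq int) (i : nat) : int := \sum_(s <- take i p) s.

Definition lukasiewicz (n : nat) (p : seq int) : Prop :=
  [/\ size p = n,
      forall s, s \in p -> -1 <= s,
      path_height p n = 0
    & forall i, (i <= n)%N -> 0 <= path_height p i].

Local Open Scope classical_set_scope.

(** Positions are counted from 1 whereas [nth] counts from 0.  The bound
    [i < size p] is needed: the default value of [nth] is the step [F]. *)
Definition UF_positions (k : nat) (p : seq int) : set nat :=
  [set i | [/\ (0 < i)%N, (i < size p)%N, p`_i.-1 = k%:Z & p`_i = 0]].

Definition UF_equiv (p q : seq int) : Prop :=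
  size p = size q /\
  forall k, (1 <= k)%N -> UF_positions k p = UF_positions k q.

Definition UF_classes (n : nat) : set (set (seq int)) :=
  [set [set q | lukasiewicz n q /\ UF_equiv p q] | p in lukasiewicz n].

(** [fset_set] is empty on infinite sets, but there are finitely many
    Łukasiewicz paths of a given length. *)
Definition UF_class_count (n : nat) : nat := #|` fset_set (UF_classes n)|%fset.

(* Main.v *)
Require Import Defs.
From HB Require Import structures.
From mathcomp Require Import all_boot all_order all_algebra finmap.
From mathcomp Require Import boolp classical_sets functions cardinality.
From mathcomp Require Import ring zify.
Set Implicit Arguments.
Unset Strict Implicit.
Unset Printing Implicit Defensive.
Import Order.TTheory GRing.Theory Num.Theory.
Local Open Scope ring_scope.

(** The occurrences of the [U_k F] being prescribed, fill the other positions
    greedily: with [D] above the x-axis and with [F] on it.  No new occurrence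
    arises, and the filled path is the lowest one with these occurrences; hence
    every class contains exactly one canonical path, made of blocks [U_k F], of
    steps [D], and of steps [F] on the x-axis.  If [H] is the series of the
    canonical paths and [E] that of the canonical descents by one unit, then
    canonical words from height [g] are counted by [E^g H], where
    [H = 1 + x H + x^2 \sum_(k >= 1) E^k H] and [(1 - E) x H = E], which gives
    [H = 1 + x H + x^3 H^2], the equation solved by [2 / (1 - x + r)]. *)

(** * Łukasiewicz words and occurrences as boolean predicates *)

Section Words.
Implicit Types (p q w : seq int) (n g : nat).

(* Łukasiewicz words from height [h] to height 0. *)
Fixpoint luk_from (h : int) p : bool :=
  if p is s :: p' then [&& -1 <= s, 0 <= h + s & luk_from (h + s) p']
  else h == 0.

(** [luk_from] tests the height after each step only; [0 <= h] covers the empty prefix. *)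
Lemma luk_fromP (h : int) p : 0 <= h ->
  luk_from h p <->
  [/\ forall s, s \in p -> -1 <= s, h + path_height p (size p) = 0
    & forall i, (i <= size p)%N -> 0 <= h + path_height p i].
Proof.
rewrite /path_height; elim: p h => [|s p IH] h h0 /=.
  split=> [/eqP->|[_]]; last by rewrite big_nil addr0 => ->.
  by split=> // [|i _]; rewrite big_nil addr0.
split=> [/and3P[s1 hs /IH [//|sp hp ip]]|[sp hp ip]].
  split=> [t|| [|i]] /=; rewrite ?big_nil ?big_cons ?addrA ?addr0 //.
    by rewrite inE => /predU1P[->|/sp].
  exact: ip.
have hs: 0 <= h + s by have := ip 1%N isT; rewrite /= take0 big_seq1.
rewrite sp ?mem_head // hs; apply/IH => //; split=> [t tp||i ile].
- by apply: sp; rewrite inE tp orbT.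
- by rewrite -addrA; rewrite big_cons in hp.
- by have := ip i.+1 ile; rewrite /= big_cons addrA.
Qed.

Lemma lukasiewiczP n p : lukasiewicz n p <-> size p = n /\ luk_from 0 p.
Proof.
split=> [[<- sp hp ip]|[<- /luk_fromP[//|sp hp ip]]]; split => //.
- by apply/luk_fromP => //; split=> // [|i /ip]; rewrite add0r.
- by move: hp; rewrite add0r.
- by move=> i /ip; rewrite add0r.
Qed.

(** Indices start at 0: [i] here is position [i.+1] of [UF_positions]. *)
Definition UF_at p (i : nat) (k : nat) : bool :=
  [&& (0 < k)%N, (i.+1 < size p)%N, p`_i == k%:Z & p`_i.+1 == 0].

Lemma UF_equivP p q :
  UF_equiv p q <-> size p = size q /\ UF_at p =2 UF_at q.
Proof.
split=> -[pq e]; split=> //.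
  move=> i [|k]; first by rewrite /UF_at.
  have /(congr1 (fun A => A i.+1)) /= := e k.+1 isT.
  rewrite /UF_positions /= => pe; apply/idP/idP.
    case/and4P=> _ a /eqP b /eqP c.
    have : [/\ (0 < i.+1)%N, (i.+1 < size p)%N,
               p`_i = k.+1%:Z & p`_i.+1 = 0] by [].
    by rewrite pe => -[_ a' b' c']; rewrite /UF_at a' b' c' !eqxx.
  case/and4P=> _ a /eqP b /eqP c.
  have : [/\ (0 < i.+1)%N, (i.+1 < size q)%N,
               q`_i = k.+1%:Z & q`_i.+1 = 0] by [].
  by rewrite -pe => -[_ a' b' c']; rewrite /UF_at a' b' c' !eqxx.
move=> k k1; apply/seteqP; split=> -[|i] [] //= _ a b c.
  have : UF_at p i k by rewrite /UF_at k1 a b c !eqxx.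
  by rewrite e => /and4P[_ a' /eqP b' /eqP c'].
have : UF_at q i k by rewrite /UF_at k1 a b c !eqxx.
by rewrite -e => /and4P[_ a' /eqP b' /eqP c'].
Qed.

(** * The greedy filling *)

(** As [0.-1] is 0, the height after this step is [g.-1] for every [g]. *)
Definition down_step g : int := if g is 0 then 0 else -1.

(* The greedy filling of [p], started at height [g]. *)
Fixpoint canon g p : seq int :=
  if p is s :: p1 then
    let c := down_step g :: canon g.-1 p1 in
    if p1 is t :: p2 then
      if (0 < s) && (t == 0) then s :: t :: canon (g + `|s|) p2 else c
    else c
  else [::].

(** Follows the recursion of [canon], which removes a block of two steps or a single step. *)
Lemma canon_ind (P : seq int -> Prop) :
  P [::] ->
  (forall k p, (0 < k)%N -> P p -> P (k%:Z :: 0 :: p)) ->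
  (forall s p, ~~ ((0 < s) && ((0 < size p)%N && (p`_0 == 0))) ->
    P p -> P (s :: p)) ->
  forall p, P p.
Proof.
move=> P0 P2 P1 p; have [m] := ubnP (size p).
elim: m p => // m IH [//|s [|t p]] /=; rewrite ltnS => lem.
  by apply: P1 => //; rewrite andbF.
have [/andP[s0 /eqP->]|nst] := boolP ((0 < s) && (t == 0)).
  case: s s0 => // k k0; apply: P2 => //; apply: IH; lia.
by apply: P1 => //; apply: IH.
Qed.

Lemma canon_block g k p : (0 < k)%N ->
  canon g (k%:Z :: 0 :: p) = k%:Z :: 0 :: canon (g + k) p.
Proof. by case: k. Qed.

Lemma canon_down g s p : ~~ ((0 < s) && ((0 < size p)%N && (p`_0 == 0))) ->
  canon g (s :: p) = down_step g :: canon g.-1 p.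
Proof. by case: p => [|t p] //= /negbTE ->. Qed.

Lemma size_canon g p : size (canon g p) = size p.
Proof.
elim/canon_ind: p g => [|k p k0 IH|s p nb IH] g //.
  by rewrite canon_block //= IH.
by rewrite canon_down //= IH.
Qed.

Lemma UF_at_nil i k : UF_at [::] i k = false.
Proof. by rewrite /UF_at /= andbF. Qed.

Lemma UF_atS s p i k : UF_at (s :: p) i.+1 k = UF_at p i k.
Proof. by []. Qed.

(** Whether [canon] keeps a block at the head depends on the occurrences alone. *)
Lemma UF_at0 s p :
  ~~ ((0 < s) && ((0 < size p)%N && (p`_0 == 0))) <->
  forall k, UF_at (s :: p) 0 k = false.
Proof.
rewrite /UF_at /= ltnS.
split=> [nb k|e]; apply/negP.
  by case/and4P=> k0 p0 /eqP sk pz; move: nb; rewrite sk p0 pz; case: k k0 {sk}.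
case/and3P => s0 p0 pz; case: s s0 e => // k k0 /(_ k).
by rewrite p0 pz eqxx -ltz_nat k0.
Qed.

Lemma UF_at_block k p i j :
  UF_at (k%:Z :: 0 :: p) i j =
  match i with 0 => (0 < k)%N && (j == k) | 1 => false
  | i.+2 => UF_at p i j end.
Proof.
case: i => [|[|i]] //; rewrite /UF_at /=.
  rewrite eqz_nat (eq_sym k); case: eqP => [->|]; rewrite /= ?andbT ?andbF //.
by case: j => [|j] //=; rewrite ?andbF.
Qed.

(** Blocks are copied, and a filling step, being [D] or [F], starts no occurrence. *)
Lemma UF_at_canon g p : UF_at (canon g p) =2 UF_at p.
Proof.
elim/canon_ind: p g => [|k p k0 IH|s p nb IH] g i j //.
  by rewrite canon_block // !UF_at_block; case: i => [|[|i]] //; exact: IH.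
rewrite canon_down //; case: i => [|i]; last by rewrite !UF_atS IH.
have /UF_at0 -> := nb.
by apply/UF_at0: j; case: g.
Qed.

Lemma UF_equiv_canon g p : UF_equiv p (canon g p).
Proof.
by apply/UF_equivP; rewrite size_canon; split=> // i k; rewrite UF_at_canon.
Qed.

(** [canon] reads only the length and the occurrences of its argument. *)
Lemma canon_UF_equiv g p q : UF_equiv p q -> canon g p = canon g q.
Proof.
move=> /UF_equivP[]; elim/canon_ind: p q g => [|k p k0 IH|s p nb IH] q g.
- by case: q.
- case: q => [|s [|t q]] // [sz] e.
  have := e 0%N k; rewrite UF_at_block k0 eqxx => /esym /and4P[_ _].
  move=> /eqP st /eqP t0; rewrite [s]st [t]t0 in e *; rewrite !canon_block //;
  congr [:: _, _ & _].
  by apply: IH => // i j; exact: (e i.+2 j).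
- case: q => [|t q] // [sz] e.
  have /UF_at0 nb0 := nb.
  have nbq: ~~ ((0 < t) && ((0 < size q)%N && (q`_0 == 0))).
    by apply/UF_at0 => j; rewrite -e.
  rewrite !canon_down //; congr (_ :: _).
  by apply: IH => // i j; exact: (e i.+1 j).
Qed.

Lemma canonK g p : canon g (canon g p) = canon g p.
Proof. by apply/esym/canon_UF_equiv/UF_equiv_canon. Qed.

Lemma luk_from_block (h : int) k p :
  luk_from h (k%:Z :: 0 :: p) = (0 <= h + k%:Z) && luk_from (h + k%:Z) p.
Proof. by rewrite /= addr0; case: (0 <= h + k%:Z). Qed.

Lemma luk_from_down g p :
  luk_from g (down_step g :: p) = luk_from g.-1 p.
Proof.
have -> : luk_from g (down_step g :: p) = luk_from (g%:Z + down_step g) p.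
  by case: g.
by congr luk_from; case: g => //= g; lia.
Qed.

(* The greedy filling stays weakly below every path with the same
   occurrences. *)
Lemma luk_from_canon (h : int) g p :
  luk_from h p -> g%:Z <= h -> luk_from g (canon g p).
Proof.
elim/canon_ind: p h g => [|k p k0 IH|s p nb IH] h g.
- by move=> /= /eqP-> ?; lia.
- rewrite canon_block // !luk_from_block => /andP[h0 lp] gh.
  by rewrite -PoszD (IH _ _ lp) ?andbT; lia.
- rewrite canon_down // luk_from_down => /= /and3P[s1 hs lp] gh.
  (* [g.-1 <= h + s] comes from [-1 <= s] if [g > 0], and from [0 <= h + s] if [g = 0]. *)
  by rewrite (IH _ _ lp); lia.
Qed.

(** * Enumeration of the canonical words *)

(* The words of length [n] from height [g] to 0 that [canon g] fixes. In the
   second part [k <= l], since [l] steps must come down from [g + k]. *)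
Fixpoint canon_words n g : seq (seq int) :=
  if n is m.+1 then
    [seq down_step g :: w | w <- canon_words m g.-1] ++
    (if m is l.+1 then
       [seq k%:Z :: 0 :: w | k <- iota 1 l, w <- canon_words l (g + k)]
     else [::])
  else if g is 0 then [:: [::]] else [::].

Lemma luk_from_le_size (h : int) p : luk_from h p -> h <= (size p)%:Z.
Proof.
elim: p h => [|s p IH] h /=; first by move/eqP->.
by case/and3P => s1 hs /IH; lia.
Qed.

Lemma nat_ind2 (P : nat -> Prop) : P 0%N -> P 1%N ->
  (forall n, P n -> P n.+1 -> P n.+2) -> forall n, P n.
Proof.
by move=> P0 P1 P2 n; suff []: P n /\ P n.+1 by []; elim: n => // n [? ?]; auto.
Qed.

Lemma canon_wordsS n g :
  canon_words n.+1 g =  [seq down_step g :: w | w <- canon_words n g.-1] ++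
    (if n is l.+1 then
       [seq k%:Z :: 0 :: w | k <- iota 1 l, w <- canon_words l (g + k)]
     else [::]).
Proof. by []. Qed.

Lemma canon_words_down n g w :
  w \in canon_words n g.-1 -> down_step g :: w \in canon_words n.+1 g.
Proof. by move=> wn; rewrite canon_wordsS mem_cat map_f. Qed.

Lemma mem_canon_words n g w :
  w \in canon_words n g <-> [/\ size w = n, luk_from g w & canon g w = w].
Proof.
split.
  elim/nat_ind2: n g w => [||n IH1 IH2] g w.
  - by case: g => // /[!inE] /eqP->.
  - by case: g => [|[|g]] // /[!inE] /eqP->.
  - rewrite canon_wordsS mem_cat => /orP[/mapP[v /IH2[sv lv cv] ->]|].
      rewrite canon_down; last by case: (g).
      by rewrite luk_from_down /= sv cv.
    case/allpairsPdep=> k [v [/[!mem_iota] /andP[k0 _] /IH1 [sv lv cv] ->]].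
    by rewrite canon_block // luk_from_block -PoszD /= sv cv lv.
(* A fixed word starts with a block or with [down_step g], matching the two parts of the list. *)
elim/canon_ind: w n g => [|k p k0 IH|s p nb IH] n g [<-].
- by move=> /= /eqP[->].
- rewrite canon_block // luk_from_block -PoszD => /= lp [cp].
  rewrite mem_cat; apply/orP; right.
  have := luk_from_le_size lp => sp.
  apply/allpairsPdep; exists k, (canon (g + k) p).
  by rewrite mem_iota cp; split=> //; [lia | exact: IH].
- rewrite canon_down // => lp [es cp]; move: lp; rewrite -{1}es => lp.
  rewrite -es; apply: canon_words_down; apply: IH; split=> //.
  by rewrite -luk_from_down.
Qed.

Lemma uniq_canon_words n g : uniq (canon_words n g).
Proof.
elim/nat_ind2: n g => [||n IH1 IH2] g; [by case: g | by case: g => [|[]] |].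
rewrite canon_wordsS cat_uniq map_inj_uniq; last by move=> ? ? [].
rewrite IH2 /=; apply/andP; split.
  (* The two parts are disjoint: only in the second is the first step positive. *)
  apply/hasPn => w /allpairsPdep[k [v [/[!mem_iota] /andP[k0 _] _ ->]]].
  by apply/mapP => -[u _ []]; case: k k0 => // k _; case: (g).
apply: allpairs_uniq_dep => [||[k v] [l u] _ _ [-> ->]] //.
exact: iota_uniq.
Qed.

Lemma size_canon_words n g : size (canon_words n.+2 g) =
  (size (canon_words n.+1 g.-1)
   + \sum_(1 <= k < n.+1) size (canon_words n (g + k)))%N.
Proof.
rewrite canon_wordsS size_cat size_map size_allpairs_dep sumnE big_map.
by rewrite /index_iota subSS subn0.
Qed.

End Words.

(** * Canonical words as representatives of the classes *)

Local Open Scope classical_set_scope.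

Definition UF_class (n : nat) (p : seq int) : set (seq int) :=
  [set q | lukasiewicz n q /\ UF_equiv p q].

Lemma UF_classesE n : UF_classes n = UF_class n @` [set` canon_words n 0].
Proof.
rewrite /UF_classes; apply/seteqP; split=> _ [p lp <-].
  have /lukasiewiczP[sp lpp] := lp.
  exists (canon 0 p).
    by apply/mem_canon_words; rewrite size_canon canonK; split=> //;
      exact: luk_from_canon lpp _.
  have [e1 e2] := UF_equiv_canon 0 p.
  apply/seteqP; split=> q [lq [e3 e4]]; split=> //; split; rewrite -?e3 // => k k1.
    by rewrite e2 // e4.
  by rewrite -e4 // e2.
have /mem_canon_words[sp lpp _] : p \in canon_words n 0 by exact: lp.
by exists p => //; apply/lukasiewiczP.
Qed.

Lemma UF_class_count_canon n : UF_class_count n = size (canon_words n 0).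
Proof.
rewrite /UF_class_count UF_classesE.
have -> : [set` canon_words n 0] = [set` [fset w in canon_words n 0]%fset].
  by apply/seteqP; split=> w /=; rewrite inE.
rewrite fset_set_image // set_fsetK card_in_imfset /=; last first.
  move=> w v; rewrite !inE => /mem_canon_words[sw lw cw]
    /mem_canon_words[_ _ cv] e.
  (* Equal classes make [w] and [v] equivalent; both are fixed by [canon 0], hence equal. *)
  have : UF_class n w w by split; [exact/lukasiewiczP | exact/UF_equivP].
  by rewrite e => -[_ /(canon_UF_equiv 0)]; rewrite cv cw => ->.
by rewrite card_fseq undup_id // uniq_canon_words.
Qed.

Local Close Scope classical_set_scope.

(** Reduces a consequence of a known equation to an identity for [ring]. *)
Lemma eq_subr (V : zmodType) (a b c d : V) : a = b -> c - d = a - b -> c = d.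
Proof. by move=> -> /eqP; rewrite subrr subr_eq0 => /eqP. Qed.

(** * Generating series of the canonical words *)

Section Series.
Variable K : fieldType.
Implicit Types f : fps K.
Local Notation x := (@fpsX K).

Lemma fcoefXM f n : fcoef (x * f) n = if n is m.+1 then fcoef f m else 0.
Proof.
case: n => [|n]; rewrite fcoefM big_ord_recl /= mul0r add0r ?big_ord0 //.
rewrite big_ord_recl /= mul1r subSS subn0 big1 ?addr0 // => i _.
by rewrite mul0r.
Qed.

Lemma fcoefXnM f m n :
  fcoef (x ^+ m * f) n = if (n < m)%N then 0 else fcoef f (n - m).
Proof.
elim: m n => [|m IH] n; first by rewrite mul1r subn0.
by rewrite exprS -mulrA fcoefXM; case: n => // n; rewrite IH.
Qed.

Variable H : fps K.
Hypothesis H_eq : H = 1 + x * H + x ^+ 3 * H ^+ 2.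

Lemma fcoef_fixpoint_rec (h : nat -> nat) : h 0%N = 1%N ->
  (forall n, h n.+1 =
     (h n + \sum_(0 <= k < n.-1) h k * h (n - 2 - k))%N) ->
  forall n, fcoef H n = (h n)%:R.
Proof.
move=> h0 hS n; elim/ltn_ind: n => -[|n] IH.
  by rewrite H_eq !fcoefD fcoefXM fcoefXnM h0 !addr0.
rewrite H_eq !fcoefD fcoefXM fcoefXnM fcoef1 add0r hS natrD IH //.
(* For [n < 2] both remaining terms vanish. *)
congr (_ + _); case: n IH => [|[|n]] IH;
  [by rewrite big_geq | by rewrite big_geq |].
rewrite -[LHS]/(fcoef (H * H) (n.+3 - 3)) fcoefM big_mkord natr_sum !subSS !subn0.
apply: eq_bigr => i _.
by rewrite natrM !IH //; case: i => /=; lia.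
Qed.

(* [E] counts the canonical words from height 1 that stop at their first visit
   to height 0. *)
Let v := (1 - x ^+ 3 * H)^-1.
Let E := x * v.

(** A descent is [D], or a block [U_k F] and then [k + 1] descents; the latter sum to
    [x^2 E^2 / (1 - E) = x^3 E H]. *)
Let E_eq : E = x + x ^+ 3 * E * H.
Proof.
have vu : (1 - x ^+ 3 * H) * v = 1.
  by rewrite divrr // fps_unitE fcoefD fcoefN fcoefXnM subr0 oner_neq0.
have := congr1 ( *%R x) vu; rewrite mulr1 => {vu} Ex.
rewrite -[X in X + _]Ex /E; ring.
Qed.

(** Multiplied by the unit [1 - x ^+ 3 * H], this is [x] times the equation of [H]. *)
Let EH_eq : (1 - E) * (x * H) = E.
Proof.
have u : 1 - x ^+ 3 * H \is a GRing.unit.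
  by rewrite fps_unitE fcoefD fcoefN fcoefXnM subr0 oner_neq0.
apply: (mulrI u).
have Eu : (1 - x ^+ 3 * H) * E = x by apply: (eq_subr E_eq); ring.
rewrite mulrA mulrBr mulr1 Eu.
apply: (@eq_subr _ (x * H) (x * (1 + x * H + x ^+ 3 * H ^+ 2))).
  by rewrite {1}H_eq.
ring.
Qed.

(* The finite sum stands for the whole series over [k >= 1], as [E ^+ k] has no
   term of degree below [k]. *)
Lemma telescope_EH g n :
  \sum_(1 <= k < n.+1) fcoef (E ^+ (g + k) * H) n =
  fcoef (E ^+ g * (x * H ^+ 2)) n.
Proof.
(* As [E = (1 - E) x H], each term is a difference of consecutive ones. *)
have step k : fcoef (E ^+ (g + k.+1) * H) n =
  fcoef (E ^+ (g + k) * (x * H ^+ 2)) n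
    - fcoef (E ^+ (g + k.+1) * (x * H ^+ 2)) n.
  rewrite -fcoefN -fcoefD; congr (fcoef _ n).
  by rewrite addnS exprS -{1}EH_eq; ring.
rewrite big_add1 [n.+1.-1]/= (@telescope_sumr_eq _ _ _
  (fun k => - fcoef (E ^+ (g + k) * (x * H ^+ 2)) n)) // => [|k _].
  (* The last term is divisible by [x ^+ (g + n).+1], so its coefficient at [n] is 0. *)
  have -> : E ^+ (g + n) * (x * H ^+ 2) =
      x ^+ (g + n).+1 * (v ^+ (g + n) * H ^+ 2).
    by rewrite exprMn (exprS x) -!mulrA (mulrCA _ x) (mulrCA _ x).
  by rewrite fcoefXnM ltnS leq_addl oppr0 add0r opprK addn0.
by rewrite step opprK addrC.
Qed.

(** The series [E ^+ g * H] obey the recurrence of [canon_words], by the equation of [H] for [g = 0]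
    and that of [E] for [g > 0]. *)
Lemma size_canon_words_coef n g :
  (size (canon_words n g))%:R = fcoef (E ^+ g * H) n.
Proof.
have F0 : E ^+ 0 * H = 1 + x * (E ^+ 0 * H) + x ^+ 2 * (E ^+ 0 * (x * H ^+ 2)).
  by rewrite expr0 [LHS]mul1r {1}H_eq; ring.
have FS h : E ^+ h.+1 * H =
    x * (E ^+ h * H) + x ^+ 2 * (E ^+ h.+1 * (x * H ^+ 2)).
  by rewrite !exprS {1}E_eq; ring.
have H0 : fcoef H 0 = 1 by rewrite H_eq !fcoefD fcoefXM fcoefXnM !addr0.
elim/nat_ind2: n g => [||n IH1 IH2] g.
- case: g => [|g]; first by rewrite expr0 mul1r H0.
  by rewrite FS fcoefD fcoefXM fcoefXnM addr0.
- case: g => [|[|g]].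
  + by rewrite F0 !fcoefD fcoefXM fcoefXnM expr0 mul1r H0 addr0 add0r.
  + by rewrite FS fcoefD fcoefXM fcoefXnM expr0 mul1r H0 addr0.
  + by rewrite FS fcoefD fcoefXM fcoefXnM addr0 FS fcoefD fcoefXM fcoefXnM addr0.
- rewrite size_canon_words natrD IH2 natr_sum.
  under eq_bigr do rewrite IH1.
  rewrite telescope_EH; case: g => [|g].
    by rewrite [X in _ = fcoef X _]F0 !fcoefD fcoefXM fcoefXnM fcoef1 add0r subn2.
  by rewrite [X in _ = fcoef X _]FS fcoefD fcoefXM fcoefXnM subn2.
Qed.

Lemma UF_class_count_coef n : (UF_class_count n)%:R = fcoef H n.
Proof. by rewrite UF_class_count_canon size_canon_words_coef mul1r. Qed.

End Series.

(** * The closed forms *)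

Theorem theorem10 :
  let C : fps rat := FPS (fun n => (UF_class_count n)%:R) in
  let x : fps rat := fpsX in
  let r : fps rat := fps_sqrt (1 - 2 * x + x ^+ 2 - 4 * x ^+ 3) in
  [/\ C = (1 - x + 2 * x ^+ 2 + r)
          / (1 - 2 * x + 2 * x ^+ 2 - 3 * x ^+ 3 + (1 - x + x ^+ 2) * r),
      (1 - x + 2 * x ^+ 2 + r)
          / (1 - 2 * x + 2 * x ^+ 2 - 3 * x ^+ 3 + (1 - x + x ^+ 2) * r)
        = 2 / (1 - x + r)
    & forall h : nat -> nat,
        h 0%N = 1%N ->
        (forall n, h n.+1 =
           (h n + \sum_(0 <= k < n.-1) h k * h (n - 2 - k))%N) ->
        forall n, UF_class_count n = h n].
Proof.
move=> C x r.
have x0 : fcoef x 0 = 0 by [].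
have r0 : fcoef r 0 = 1 by [].
have rr : r ^+ 2 = 1 - 2 * x + x ^+ 2 - 4 * x ^+ 3.
  apply: fps_sqr_sqrt => //.
  have -> : 1 - 2 * x + x ^+ 2 - 4 * x ^+ 3 = 1 + x * (x - 2 - 4 * x ^+ 2).
    by ring.
  by rewrite fcoefD fcoefXM addr0.
set N := 1 - x + 2 * x ^+ 2 + r.
set M := 1 - 2 * x + 2 * x ^+ 2 - 3 * x ^+ 3 + _.
set D := 1 - x + r.
have Du : D \is a GRing.unit.
  by rewrite fps_unitE !fcoefD fcoefN x0 r0.
have Mu : M \is a GRing.unit.
  have -> : M = 1 + r + x * (- 2 + 2 * x - 3 * x ^+ 2 + (x - 1) * r).
    by rewrite /M; ring.
  by rewrite fps_unitE !fcoefD fcoefXM r0.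
have NM : N / M = 2 / D.
  apply: (mulIr Mu); apply: (mulIr Du).
  rewrite divrK // -mulrAC divrK //.
  (* Cleared of denominators, the two sides differ by [r ^+ 2] minus the radicand. *)
  by apply: (eq_subr rr); rewrite /N /M /D; ring.
(* [2 / D] is a root of [x^3 H^2 - (1 - x) H + 1], of discriminant [(1 - x)^2 - 4 x^3 = r^2], in a
   form that avoids dividing by [x^3]. *)
have H_eq : 2 / D = 1 + x * (2 / D) + x ^+ 3 * (2 / D) ^+ 2.
  have e : 2 / D * D = 2 by rewrite divrK.
  apply: (mulIr Du); apply: (mulIr Du).
  rewrite e.
  have -> : (1 + x * (2 / D) + x ^+ 3 * (2 / D) ^+ 2) * D * D =
    D ^+ 2 + x * (2 / D * D) * D + x ^+ 3 * (2 / D * D) ^+ 2 by ring.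
  rewrite e.
  by apply/esym/(eq_subr rr); rewrite /D; ring.
have CH : C = 2 / D by apply: fpsP => n; rewrite -(UF_class_count_coef H_eq).
split=> // [|h h0 hS n]; first by rewrite NM.
apply/eqP; rewrite -(eqr_nat rat) (UF_class_count_coef H_eq).
by rewrite (fcoef_fixpoint_rec H_eq h0 hS).
Qed.
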